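(* The Neumann initial value problem $$\partial_t u=\Delta\phi(u)\ \text{in }\Omega,\qquad \frac{\partial\phi(u)}{\partial\hat n}=0\ \text{on }\partial\Omega,\qquad u(0,x)=u_0(x)$$ always has a unique global grid solution.
   Context: Nonstandard analysis is used; ${}^*$ denotes the nonstandard extension and ${}^\circ$ the standard part. $\Omega\subseteq\mathbb{R}^k$ is open, bounded and connected with smooth boundary and unit exterior normal $\hat n$; $u_0\in L^\infty(\Omega)$ with $u_0(x)\ge 0$ for all $x\in\Omega$ (a fixed representative). Hypotheses on $\phi$: $\phi\in C^1(\mathbb{R})$; $\phi(x)\ge 0$ for all $x\ge 0$ and $\phi(0)=0$; there are $0<u^-<u^+\le+\infty$ such that $\phi'(u)>0$ for $u\in(0,u^-)\cup(u^+,+\infty)$ and $\phi'(u)<0$ for $u\in(u^-,u^+)$; if $u^+=+\infty$ then $\lim_{x\to+\infty}\phi(x)=0$. Grid. Fix an infinite $N_0\in{}^*\mathbb{N}$, $N=N_0!$, $\varepsilon=1/N$, $\mathbb{X}=\{n\varepsilon: n\in[-N^2,N^2]\cap{}^*\mathbb{Z}\}$, $\Omega_{\mathbb{X}}={}^*\Omega\cap\mathbb{X}^k$ (hyperfinite). $\mathbb{G}(\Omega)$ is the set of internal functions $f:\Omega_{\mathbb{X}}\to{}^*\mathbb{R}$, $\langle f,g\rangle=\varepsilon^k\sum_{x\in\Omega_{\mathbb{X}}}f(x)g(x)$. Equivalence. A point of $\Omega_{\mathbb{X}}$ is nearstandard if infinitesimally close to a point of $\Omega$. $f\in S^0(\Omega)$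 iff $f(x)$ is finite for some nearstandard $x$ and $x\approx y$ implies $f(x)\approx f(y)$ for nearstandard $x,y\in\Omega_{\mathbb{X}}$; $f\in S^\infty(\Omega)$ iff all iterated forward difference quotients $\mathbb{D}^\alpha f$ of step $\varepsilon$ ($\alpha$ a standard multi-index) are in $S^0(\Omega)$; $\mathscr{D}_{\mathbb{X}}(\Omega)=\{f\in S^\infty(\Omega):{}^\circ\mathrm{supp}f\subset\subset\Omega\}$. $f\equiv g$ iff $\langle f,\varphi\rangle\approx\langle g,\varphi\rangle$ for all $\varphi\in\mathscr{D}_{\mathbb{X}}(\Omega)$; $[f]$ is the class of $f$. Grid Laplacian with Neumann conditions: $\Delta_{\mathbb{X}}{}^*\phi(u)(x)=\varepsilon^{-2}\sum_{y}({}^*\phi(u(y))-{}^*\phi(u(x)))$, the sum over those $y\in\Omega_{\mathbb{X}}$ of the form $x\pm\varepsilon e_i$, $1\le i\le k$. Grid solution: the pair of functions $[u],[{}^*\phi(u)]:[0,+\infty)\to\mathbb{G}(\Omega)/\equiv$, $t\mapsto[u(t)]$, $t\mapsto[{}^*\phi(u(t))]$, is called a (global) grid solution of the problem if $u\in{}^*C^1({}^*[0,+\infty),\mathbb{G}(\Omega))$ satisfies $u_t=\Delta_{\mathbb{X}}{}^*\phi(u)$ and $u(0,x)={}^*u_0(x)$ for $x\in\Omega_{\mathbb{X}}$. *)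

(* Defs.v *)
From HB Require Import structures.
From mathcomp Require Import all_boot all_order all_algebra.
From mathcomp Require Import all_classical all_reals all_analysis.

Set Implicit Arguments.
Unset Strict Implicit.
Unset Printing Implicit Defensive.

Import Order.TTheory GRing.Theory Num.Theory.
Import numFieldNormedType.Exports.

Local Open Scope classical_set_scope.
Local Open Scope ring_scope.
Local Open Scope quotient_scope.

(* The nonstandard extension is the ultrapower [star U T] = T^I / U, for an
   ultrafilter U on an arbitrary index type I; internal objects of type T are
   the elements of [star U T].  The definitions make sense for every filter U;
   maximality is assumed in the theorem. *)
Section Star.
Variables (I : Type) (U : filter_on I).

Definition ueq (T : Type) (f g : {classic (I -> T)}) : bool :=
  `[< \forall i \near U, (f : I -> T) i = (g : I -> T) i >].

Lemma ueq_equiv (T : Type) : equiv_class_of (@ueq T).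
Proof.
split.
- by move=> f; apply/asboolP; apply: filterE.
- by move=> f g; apply/asboolP/asboolP; apply: filterS => i ->.
- move=> g f h /asboolP fg /asboolP gh; apply/asboolP.
  by apply: filterS2 fg gh => i -> ->.
Qed.

Canonical ueq_equivRel (T : Type) := EquivRelPack (@ueq_equiv T).

Definition star (T : Type) := {eq_quot (ueq_equivRel T)}.

Definition star_of (T : Type) (f : I -> T) : star T :=
  \pi_(star T) (f : {classic (I -> T)}).

Definition std (T : Type) (a : T) : star T := star_of (fun=> a).

Definition sapp (A B : Type) (F : star (A -> B)) (x : star A) : star B :=
  star_of (fun i => (repr F : I -> A -> B) i ((repr x : I -> A) i)).

(* Truth of an internal proposition. *)
Definition holds (p : star Prop) : Prop := p = std True.

Lemma star_of_eq (T : Type) (f g : I -> T) :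
  star_of f = star_of g <-> \forall i \near U, f i = g i.
Proof. by split=> [/eqmodP/asboolP | fg]; last apply/eqmodP/asboolP. Qed.

Lemma star_ofP (T : Type) (x : star T) : exists f, x = star_of f.
Proof. by exists (repr x); rewrite /star_of reprK. Qed.

Lemma repr_star_of (T : Type) (f : I -> T) :
  \forall i \near U, (repr (star_of f) : I -> T) i = f i.
Proof. by apply/star_of_eq; rewrite /star_of reprK. Qed.

Lemma sapp_star_of (A B : Type) (F : I -> A -> B) (x : I -> A) :
  sapp (star_of F) (star_of x) = star_of (fun i => F i (x i)).
Proof.
apply/star_of_eq; apply: filterS2 (repr_star_of F) (repr_star_of x).
by move=> i -> ->.
Qed.

Lemma holdsP (P : I -> Prop) :
  holds (star_of P) <-> \forall i \near U, P i.
Proof.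
split=> [/star_of_eq | HP]; last apply/star_of_eq.
  by apply: filterS => i ->.
by apply: filterS HP => i Pi; apply/propext.
Qed.

Definition star_pred (A : Type) (P : A -> Prop) (x : star A) : Prop :=
  holds (sapp (std P) x).

Definition star_rel (A B : Type) (r : A -> B -> Prop)
    (x : star A) (y : star B) : Prop :=
  holds (sapp (sapp (std r) x) y).

Lemma star_predE (A : Type) (P : A -> Prop) (x : I -> A) :
  star_pred P (star_of x) <-> \forall i \near U, P (x i).
Proof. by rewrite /star_pred /std sapp_star_of holdsP. Qed.

Lemma star_relE (A B : Type) (r : A -> B -> Prop) (x : I -> A) (y : I -> B) :
  star_rel r (star_of x) (star_of y) <-> \forall i \near U, r (x i) (y i).
Proof. by rewrite /star_rel /std !sapp_star_of holdsP. Qed.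

Definition infinite_hypernat (n : star nat) : Prop :=
  forall m : nat, star_rel (fun a b : nat => (a < b)%N) (std m) n.

Section Infinitesimals.
Variables (R : realType) (V : normedModType R).

Definition sapprox (x y : star V) : Prop :=
  forall e : R, 0 < e -> star_rel (fun a b : V => `|a - b| < e) x y.

Definition sfinite (x : star V) : Prop :=
  exists M : R, star_pred (fun a : V => `|a| <= M) x.

Lemma sapprox_refl x : sapprox x x.
Proof.
have [f ->] := star_ofP x => e e0; apply/star_relE; apply: filterE => i.
by rewrite subrr normr0.
Qed.

Lemma sapprox_sym x y : sapprox x y -> sapprox y x.
Proof.
have [f ->] := star_ofP x; have [g ->] := star_ofP y => fg e e0.
apply/star_relE; have /star_relE := fg e e0.
by apply: filterS => i; rewrite distrC.
Qed.

Lemma sapprox_trans y x z : sapprox x y -> sapprox y z -> sapprox x z.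
Proof.
have [f ->] := star_ofP x; have [g ->] := star_ofP y.
have [h ->] := star_ofP z => fg gh e e0; apply/star_relE.
have e20 : 0 < e / 2 by rewrite divr_gt0.
have /star_relE H1 := fg _ e20; have /star_relE H2 := gh _ e20.
apply: filterS2 H1 H2 => i H1 H2; rewrite (splitr e).
by rewrite (le_lt_trans (ler_distD (g i) _ _))// ltrD.
Qed.

End Infinitesimals.

End Star.

Notation "F <@> x" := (sapp F x) (at level 40, left associativity).

(* Objects at a standard grid parameter n, with step 1/n.  A function on the
   finite grid [gridOmega Omega n] is represented by a function on the whole of
   R^k of which only the values on the grid matter. *)
Section StandardGrid.
Variables (R : realType) (k : nat).
Local Notation point := 'rV[R]_k.
Local Notation e_ i := (delta_mx 0 i : point).

Definition gridX (n : nat) : set R :=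
  [set x | exists m : int, (`|m| <= n ^ 2)%N /\ x = m%:~R / n%:R].

Definition gridOmega (Omega : set point) (n : nat) : set point :=
  [set x | Omega x /\ forall j, gridX n (x ord0 j)].

Definition grid_pairing (Omega : set point) (n : nat) (f g : point -> R) : R :=
  n%:R^-1 ^+ k * \sum_(x \in gridOmega Omega n) f x * g x.

Definition fdiff (n : nat) (i : 'I_k) (f : point -> R) : point -> R :=
  fun x => (f (x + n%:R^-1 *: e_ i) - f x) / n%:R^-1.

(* Forward differences in different directions commute, so the order in which
   the directions are enumerated is immaterial. *)
Definition mfdiff (n : nat) (alpha : 'I_k -> nat) (f : point -> R) :
    point -> R :=
  foldr (fun i g => iter (alpha i) (fdiff n i) g) f (enum 'I_k).

(* Discrete Neumann Laplacian: neighbours x +- e_i / n outside of the grid are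
   dropped from the sum. *)
Definition grid_lap (Omega : set point) (n : nat) (f : point -> R) :
    point -> R :=
  fun x => n%:R^-1 ^- 2 *
    \sum_(i < k) \sum_(b : bool)
      (let y := x + (-1) ^+ b *: (n%:R^-1 *: e_ i) in
       if y \in gridOmega Omega n then f y - f x else 0).

Definition time_quot (w : R -> R) (t : R) : R -> R :=
  fun s => (w s - w t) / (s - t).

(* Derivative relative to [0, +oo), i.e. one-sided at t = 0. *)
Definition time_deriv (w : R -> R) (t : R) : R :=
  lim (time_quot w t s @[s --> within `[0, +oo[ t^']).

Definition C1_halfline (w : R -> R) : Prop :=
  (forall t : R, 0 <= t -> cvg (time_quot w t s @[s --> within `[0, +oo[ t^'])) /\
  {within `[0, +oo[, continuous (time_deriv w)}.

(* C^1([0, +oo), G(Omega)) at parameter n; the space of grid functions is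
   finite dimensional, hence C^1 means C^1 at every grid point. *)
Definition C1_grid (Omega : set point) (n : nat) (u : R -> point -> R) : Prop :=
  forall x, gridOmega Omega n x -> C1_halfline (u ^~ x).

End StandardGrid.

Section Grid.
Variables (I : Type) (U : filter_on I) (R : realType) (k : nat).
Variables (Omega : set 'rV[R]_k) (N0 : star U nat).
Local Notation point := 'rV[R]_k.

Definition gridN : star U nat := std U factorial <@> N0.

Definition OmegaX (x : star U point) : Prop :=
  holds (std U (gridOmega Omega) <@> gridN <@> x).

(* Internal functions Omega_X -> *R, represented by internal functions on
   *(R^k).  All notions below, in particular [gequiv], only depend on the values
   on Omega_X: a difference quotient [gdiff alpha f] at a point x nearstandard
   in the open set Omega only involves values of f on Omega_X. *)
Definition gridfun := star U (point -> R).

Definition gpairing (f g : gridfun) : star U R :=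
  std U (grid_pairing Omega) <@> gridN <@> f <@> g.

Definition gdiff (alpha : 'I_k -> nat) (f : gridfun) : gridfun :=
  std U (@mfdiff R k) <@> gridN <@> std U alpha <@> f.

Definition glap (f : gridfun) : gridfun :=
  std U (grid_lap Omega) <@> gridN <@> f.

Definition gcomp (phi : R -> R) (f : gridfun) : gridfun :=
  std U (fun g : point -> R => phi \o g) <@> f.

Definition nearstandard (x : star U point) : Prop :=
  OmegaX x /\ exists2 p, Omega p & sapprox x (std U p).

Definition S0 (f : gridfun) : Prop :=
  (exists2 x, nearstandard x & sfinite (f <@> x)) /\
  (forall x y, nearstandard x -> nearstandard y ->
     sapprox x y -> sapprox (f <@> x) (f <@> y)).

Definition Sinfty (f : gridfun) : Prop := forall alpha, S0 (gdiff alpha f).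

Definition std_supp (f : gridfun) : set point :=
  [set p : point |
     exists x, [/\ OmegaX x, f <@> x <> std U 0 & sapprox x (std U p)]].

Definition grid_test (f : gridfun) : Prop :=
  [/\ Sinfty f, compact (closure (std_supp f)) &
      closure (std_supp f) `<=` Omega].

Definition gequiv (f g : gridfun) : bool :=
  `[< forall psi, grid_test psi -> sapprox (gpairing f psi) (gpairing g psi) >].

Lemma gequiv_equiv : equiv_class_of gequiv.
Proof.
split.
- by move=> f; apply/asboolP => psi _; exact: sapprox_refl.
- by move=> f g; apply/asboolP/asboolP => fg psi /fg; exact: sapprox_sym.
- move=> g f h /asboolP fg /asboolP gh; apply/asboolP => psi psiD.
  exact: sapprox_trans (fg _ psiD) (gh _ psiD).
Qed.

Canonical gequiv_equivRel := EquivRelPack gequiv_equiv.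

Definition gdistr := {eq_quot gequiv_equivRel}.

Definition gclass (f : gridfun) : gdistr := \pi_gdistr f.

Definition solves (phi : R -> R) (u0 : point -> R)
    (u : star U (R -> point -> R)) : Prop :=
  [/\ holds (std U (C1_grid Omega) <@> gridN <@> u),
      (forall (t : star U R) (x : star U point),
        star_pred (fun s : R => 0 <= s) t -> OmegaX x ->
        std U (fun (v : R -> point -> R) s y => time_deriv (v ^~ y) s)
          <@> u <@> t <@> x
        = glap (gcomp phi (u <@> t)) <@> x) &
      (forall x, OmegaX x -> u <@> std U 0 <@> x = std U u0 <@> x)].

Definition grid_solution (phi : R -> R) (u0 : point -> R)
    (p : ({t : R | 0 <= t} -> gdistr) * ({t : R | 0 <= t} -> gdistr)) : Prop :=
  exists2 u, solves phi u0 u &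
    p = (fun t => gclass (u <@> std U (sval t)),
         fun t => gclass (gcomp phi (u <@> std U (sval t)))).

End Grid.

Arguments grid_solution {I U R k} Omega N0 phi u0 p.

Section Domain.
Variables (R : realType) (k : nat).
Local Notation point := 'rV[R]_k.
Local Notation e_ i := (delta_mx 0 i : point).

Fixpoint Cn_on (n : nat) (V : set point) (f : point -> R) : Prop :=
  (forall x, V x -> {for x, continuous f}) /\
  (if n is m.+1 then
     forall j : 'I_k,
       (forall x, V x -> derivable f x (e_ j)) /\
       Cn_on m V ('D_(e_ j) f)
   else True).

Definition smooth_on (V : set point) (f : point -> R) : Prop :=
  forall n, Cn_on n V f.

Definition gradient (f : point -> R) (x : point) : point :=
  \row_j 'D_(e_ j) f x.

Definition norm2 (v : point) : R := Num.sqrt (\sum_j v ord0 j ^+ 2).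

(* The open set Omega has a smooth boundary with unit exterior normal nhat:
   near each boundary point it is {rho < 0} for a smooth rho without critical
   points, and nhat is the normalized gradient of rho there. *)
Definition smooth_boundary (Omega : set point) (nhat : point -> point) : Prop :=
  forall p : point, (closure Omega `\` Omega) p ->
    exists (V : set point) (rho : point -> R),
      [/\ open V /\ V p, smooth_on V rho,
          forall x, V x -> gradient rho x <> 0,
          forall x, V x -> (Omega x <-> rho x < 0) &
          nhat p = (norm2 (gradient rho p))^-1 *: gradient rho p].

Definition box (a b : point) : set point :=
  [set x | forall j, a ord0 j < x ord0 j < b ord0 j].

Definition box_volume (a b : point) : R :=
  \prod_j Num.max (b ord0 j - a ord0 j) 0.

(* Lebesgue outer measure on R^k, for k > 0. *)
Definition lebesgue_outer (X : set point) : \bar R :=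
  ereal_inf [set (\sum_(0 <= n <oo) (box_volume (ab n).1 (ab n).2)%:E)%E
    | ab in [set ab : nat -> point * point
             | X `<=` \bigcup_n box (ab n).1 (ab n).2]].

(* u is a representative of an element of L^infinity(Omega). *)
Definition in_Linfty (Omega : set point) (u : point -> R) : Prop :=
  (forall c, caratheodory_measurable lebesgue_outer
               (Omega `&` [set x | c < u x])) /\
  (exists M : R, lebesgue_outer (Omega `&` [set x | M < `|u x|]) = 0%E).

End Domain.

Definition phi_hyp (R : realType) (phi : R -> R) : Prop :=
  [/\ (forall x : R, derivable phi x 1) /\ continuous (derive1 phi),
      (forall x : R, 0 <= x -> 0 <= phi x) /\ phi 0 = 0 &
      exists (um : R) (up : \bar R),
        [/\ 0 < um /\ (um%:E < up)%E,
            forall x : R, (0 < x < um) \/ (up < x%:E)%E -> 0 < derive1 phi x,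
            forall x : R, um < x -> (x%:E < up)%E -> derive1 phi x < 0 &
            up = +oo%E -> phi x @[x --> +oo] --> 0]].

(* Main.v *)
Require Import Defs.
From mathcomp Require Import all_boot all_order all_algebra.
From mathcomp Require Import all_classical all_reals all_analysis.
From mathcomp Require Import ring lra.
Import Order.TTheory GRing.Theory Num.Theory.
Import numFieldNormedType.Exports.
Local Open Scope classical_set_scope.
Local Open Scope ring_scope.

(* By ultraproduct transfer it suffices to solve, at each standard grid
   parameter, a finite system of ordinary differential equations, existence and
   uniqueness holding at every index.  Locally the vector field is Lipschitz, as
   phi is C^1; global existence comes from the invariants of the discrete Neumann
   problem: the solution stays nonnegative, since phi vanishes at 0 and is
   nonnegative on the right, and its total mass is conserved, since the discrete
   Laplacian sums to 0 over the grid. *)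

(** * Preliminaries of real analysis: geometric limits, mean value estimates, antiderivatives *)

Lemma le_geometric_error (R : realType) (a b c : R) :
  (forall n, a <= b + c * 2^-1 ^+ n) -> a <= b.
Proof.
move=> abc; apply/ler_addgt0Pr => e e0.
have h : (fun n => c * 2^-1 ^+ n) @ \oo --> (0 : R).
  rewrite -(mulr0 c); apply: cvgMr; apply: cvg_expr.
  by rewrite ger0_norm// invf_lt1// ltr1n.
have /cvgrPdist_lt /(_ e e0) [n _ /(_ n (leqnn n))] := h.
rewrite /= sub0r normrN => /(le_lt_trans (ler_norm _)) cn.
by rewrite (le_trans (abc n))// lerD2l ltW.
Qed.

(** The intervals of radius [2 * D * 2^-1 ^+ n] around [u n] are nested, this radius being the tail
    [D * 2^-1 ^+ n + D * 2^-1 ^+ n.+1 + ...]. The supremum of their left endpoints lies in all of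
    them. *)
Lemma geometric_cauchy_limit (R : realType) (u : nat -> R) (D : R) :
  (forall n, `|u n.+1 - u n| <= D * 2^-1 ^+ n) ->
  exists l, forall n, `|u n - l| <= 2 * D * 2^-1 ^+ n.
Proof.
move=> uD.
have D0 n : 0 <= D * 2^-1 ^+ n by rewrite (le_trans _ (uD n)).
pose a n := u n - 2 * D * 2^-1 ^+ n; pose b n := u n + 2 * D * 2^-1 ^+ n.
have aS n : a n <= a n.+1.
  by rewrite /a exprS; have := uD n; rewrite ler_norml; lra.
have bS n : b n.+1 <= b n.
  by rewrite /b exprS; have := uD n; rewrite ler_norml; lra.
have ab n : a n <= b n by rewrite /a /b; have := D0 n; lra.
have ale m n : (m <= n)%N -> a m <= a n.
  by move=> mn; exact: (nondecreasing_seqP a).1 aS _ _ mn.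
have bge m n : (m <= n)%N -> b n <= b m.
  by move=> mn; exact: (nonincreasing_seqP b).1 bS _ _ mn.
have abmn m n : a m <= b n.
  have /le_trans-> // := ale _ _ (leq_maxl m n).
  exact: le_trans (ab _) (bge _ _ (leq_maxr m n)).
exists (sup (range a)) => n.
have h1 : a n <= sup (range a).
  by apply: ub_le_sup; [exists (b 0) => _ [m _ <-] | exists n].
have h2 : sup (range a) <= b n.
  by apply: ge_sup; [exists (a 0); exists 0 | move=> _ [m _ <-]].
by move: h1 h2; rewrite /a /b ler_norml; lra.
Qed.

Lemma is_derive_expRM (R : realType) (C K x : R) :
  is_derive x 1 (fun y => C * expR (K * y)) (C * K * expR (K * x)).
Proof.
have h : is_derive x 1 (fun y => K * y) K.
  by have := is_deriveZ K (is_derive_id x (1 : R)); rewrite [_ *: 1]mulr1.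
apply: is_derive_eq (is_deriveZ C (is_derive1_comp (is_derive_expR (K * x)) h)) _.
by rewrite /GRing.scale/=; ring.
Qed.

Lemma bounded_derive_lipschitz (R : realType) (f df : R -> R) (B s t : R) :
  s <= t ->
  (forall x, s < x < t -> is_derive x 1 f (df x)) ->
  {within `[s, t], continuous f} ->
  (forall x, s <= x <= t -> `|df x| <= B) ->
  `|f t - f s| <= B * (t - s).
Proof.
move=> st dfx fc dfB.
have dfi x : x \in `]s, t[%R -> is_derive x 1 f (df x).
  by move=> xst; apply: dfx; rewrite !(itvP xst).
have [c cst ->] := MVT_segment st dfi fc.
rewrite normrM (ger0_norm (x := t - s)) ?subr_ge0// ler_wpM2r ?subr_ge0//.
by apply: dfB; rewrite !(itvP cst).
Qed.

(* The exponentially weighted norm sup_t e^(-K t) |f t| is contracted by the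
   factor 1/K under integration. *)
Lemma weighted_integration (R : realType) (f df : R -> R) (C K T : R) :
  0 <= T -> 0 <= C -> f 0 = 0 ->
  (forall x, 0 < x < T -> is_derive x 1 f (df x)) ->
  {within `[0, T], continuous f} ->
  (forall x, 0 <= x <= T -> `|df x| <= C * K * expR (K * x)) ->
  `|f T| <= C * expR (K * T).
Proof.
move=> T0 C0 f0 dfx fc dfC.
have ec : {within `[0, T], continuous (fun x => C * expR (K * x))}.
  apply: derivable_within_continuous => x _.
  by have [] := is_derive_expRM _ C K x.
(* Both [C * expR (K * x) + f x] and [C * expR (K * x) - f x] have a nonnegative derivative, and
   both equal [C >= 0] at 0; by the mean value theorem they are nonnegative at [T]. *)
rewrite ler_norml -subr_ge0 opprK -[X in _ && X]subr_ge0.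
apply/andP; split.
- have [|x|c cT] := @MVT_segment _ (f + (fun x => C * expR (K * x)))
    (fun x => df x + C * K * expR (K * x)) 0 T T0.
  + move=> x xT; apply: is_deriveD; last exact: is_derive_expRM.
    by apply: dfx; rewrite !(itvP xT).
  + by apply: continuousD; [exact: fc|exact: ec].
  rewrite !fctE f0 mulr0 expR0.
  have : `|df c| <= C * K * expR (K * c) by apply: dfC; rewrite !(itvP cT).
  rewrite ler_norml => /andP[h _] e.
  have : 0 <= (df c + C * K * expR (K * c)) * (T - 0).
    by rewrite mulr_ge0//; lra.
  move: e; lra.
- have [|x|c cT] := @MVT_segment _ ((fun x => C * expR (K * x)) - f)
    (fun x => C * K * expR (K * x) - df x) 0 T T0.
  + move=> x xT; apply: is_deriveB; first exact: is_derive_expRM.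
    by apply: dfx; rewrite !(itvP xT).
  + by apply: continuousB; [exact: ec|exact: fc].
  have : `|df c| <= C * K * expR (K * c) by apply: dfC; rewrite !(itvP cT).
  rewrite ler_norml => /andP[_ h].
  have : 0 <= (C * K * expR (K * c) - df c) * (T - 0).
    by rewrite mulr_ge0//; lra.
  rewrite !fctE f0 mulr0 expR0; lra.
Qed.

Lemma antiderivative_exists (R : realType) (f : R -> R) : continuous f ->
  exists G : R -> R, G 0 = 0 /\ forall t : R, 0 <= t -> is_derive t 1 G (f t).
Proof.
move=> fc.
(* Integrating from -1 makes 0 an interior point, so that the derivative at 0 is two-sided. *)
pose F (x : R) : R := (\int[lebesgue_measure]_(t in `[(-1)%R, x]) f t)%R.
have dF (t : R) : 0 <= t -> is_derive t 1 F (f t).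
  move=> t0; have [||||/= dF Ft] := @continuous_FTC1_closed R f (-1) t (t + 1).
  - by rewrite ltrDl.
  - apply: continuous_compact_integrable; first exact: segment_compact.
    exact: continuous_subspaceT.
  - lra.
  - exact: fc.
  by rewrite -Ft derive1E; exact: derivableP.
exists (F - cst (F 0)); split; first by rewrite !fctE subrr.
by move=> t t0; rewrite -[f t]subr0; apply: is_deriveB; exact: dF.
Qed.

Lemma lipschitz_continuous (R : realType) (f : R -> R) (L : R) :
  (forall s t, `|f s - f t| <= L * `|s - t|) -> continuous f.
Proof.
move=> fL t; apply/cvgrPdist_le => e e0; near=> s.
have L0 : 0 <= `|L| by [].
rewrite (le_trans (fL _ _))// (@le_trans _ _ ((`|L| + 1) * `|t - s|))//.
  by rewrite ler_wpM2r// (le_trans (ler_norm _))// lerDl.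
rewrite mulrC -ler_pdivlMr; last by lra.
near: s; apply: cvgr_dist_le; first exact: cvg_id.
by rewrite divr_gt0//; lra.
Unshelve. all: by end_near. Qed.

Lemma is_derive_continuous_segment (R : realType) (f df : R -> R) (s t : R) :
  (forall x, s <= x <= t -> is_derive x 1 f (df x)) ->
  {within `[s, t], continuous f}.
Proof.
move=> dfx; apply: derivable_within_continuous => x.
by rewrite in_itv => /dfx[].
Qed.

Lemma max0_lipschitz (R : realType) (s t : R) :
  `|Num.max s 0 - Num.max t 0| <= `|s - t|.
Proof.
rewrite !maxEle; case: ifP => h1; case: ifP => h2; rewrite ler_norml;
  have := ler_norm (s - t); have := ler_norm (t - s); rewrite (distrC t); lra.
Qed.

(** * Picard iteration for a bounded, globally Lipschitz vector field *)

Section BoundedLipschitzODE.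
Context {R : realType} {X : Type}.
Variables (F : (X -> R) -> X -> R) (L B : R) (a0 : X -> R).
Hypothesis L0 : 0 < L.
Hypothesis B0 : 0 <= B.
Hypothesis F_bounded : forall a x, `|F a x| <= B.
Hypothesis F_lipschitz : forall a b (d : R),
  (forall x, `|a x - b x| <= d) -> forall x, `|F a x - F b x| <= L * d.

(** With this exponent one Picard step contracts the weighted norm by [L / K], that is by one
    half. *)
Let K := 2 * L.

Let K0 : 0 < K.
Proof. by rewrite mulr_gt0. Qed.

Let lip_path (w : R -> X -> R) := forall (s t : R) x, 0 <= s -> 0 <= t ->
  `|w s x - w t x| <= B * `|s - t|.

Let near_path (D : R) (v w : R -> X -> R) := forall (t : R) x, 0 <= t ->
  `|v t x - w t x| <= D * expR (K * t).

(** Paths are controlled at nonnegative times only; freezing the path at time 0 for [s < 0] gives an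
    integrand continuous on the whole line, as [antiderivative_exists] requires. *)
Let field_continuous w x : lip_path w ->
  continuous (fun s : R => F (w (Num.max s 0)) x).
Proof.
move=> wB; apply: (@lipschitz_continuous _ _ (L * B)) => s t.
rewrite -mulrA; apply: F_lipschitz => y.
rewrite (le_trans (wB _ _ _ _ _))// ?le_max ?lexx ?orbT//.
by rewrite ler_wpM2l ?max0_lipschitz// B0.
Qed.

(** The new path is [a0] plus the integral of [F] along [w]. Its derivative is bounded by [B], so
    the class [lip_path] is preserved with the same constant and the step can be iterated. *)
Let picard_step w : lip_path w -> exists v, lip_path v /\
  forall x, v 0 x = a0 x /\
    forall t : R, 0 <= t -> is_derive t 1 (v ^~ x) (F (w t) x).
Proof.
move=> wB.
have /choice[v vP] x : exists G : R -> R, G 0 = a0 x /\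
    forall t : R, 0 <= t -> is_derive t 1 G (F (w t) x).
  have [G [G0 dG]] := antiderivative_exists _ _ (field_continuous w x wB).
  exists (G + cst (a0 x)); rewrite !fctE G0 add0r; split=> // t t0.
  rewrite -[F _ _]addr0 -[in w t](max_idPl t0).
  by apply: is_deriveD; exact: dG.
exists (fun t x => v x t); split; last exact: vP.
suff mono s t x : 0 <= s -> s <= t -> `|v x t - v x s| <= B * `|t - s|.
  move=> s t x s0 t0; have [st|/ltW ts] := leP s t; last exact: mono.
  by rewrite distrC (distrC s); exact: mono.
move=> s0 st; rewrite (ger0_norm (x := t - s)) ?subr_ge0//.
apply: (@bounded_derive_lipschitz _ _ (fun t => F (w t) x)) => //.
- by move=> y /andP[sy _]; apply: (vP x).2; lra.
- by apply: is_derive_continuous_segment => y /andP[sy _]; apply: (vP x).2; lra.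
Qed.

Let picard_contraction D (v w v' w' : R -> X -> R) :
  (forall x, v' 0 x = a0 x /\
    forall t : R, 0 <= t -> is_derive t 1 (v' ^~ x) (F (v t) x)) ->
  (forall x, w' 0 x = a0 x /\
    forall t : R, 0 <= t -> is_derive t 1 (w' ^~ x) (F (w t) x)) ->
  near_path D v w -> near_path (D / 2) v' w'.
Proof.
move=> v'P w'P vw t x t0.
have dvw (s : R) : 0 <= s -> is_derive s 1 (v' ^~ x - w' ^~ x) (F (v s) x - F (w s) x).
  by move=> s0; apply: is_deriveB; [apply: (v'P x).2|apply: (w'P x).2].
apply: (weighted_integration _ (v' ^~ x - w' ^~ x)
  (fun s => F (v s) x - F (w s) x) _ _ _ t0).
- have := vw 0 x (lexx _); rewrite mulr0 expR0 mulr1 => /(le_trans (normr_ge0 _)).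
  lra.
- by rewrite !fctE (v'P x).1 (w'P x).1 subrr.
- by move=> s /andP[s0 _]; apply: dvw; lra.
- by apply: is_derive_continuous_segment => s /andP[s0 _]; exact: dvw.
- move=> s /andP[s0 _]; rewrite (_ : _ * _ * _ = L * (D * expR (K * s))).
    by apply: F_lipschitz => y; exact: vw.
  by rewrite /K; field.
Qed.

Lemma bounded_lipschitz_ode : exists w : R -> X -> R,
  [/\ w 0 = a0, forall x, continuous (fun t : R => F (w (Num.max t 0)) x) &
    forall (t : R) x, 0 <= t -> is_derive t 1 (w ^~ x) (F (w t) x)].
Proof.
(* To be a total function, the step returns its argument when the path is not Lipschitz. *)
have /choice[P PP] w : exists v, lip_path w -> lip_path v /\
    forall x, v 0 x = a0 x /\
      forall t : R, 0 <= t -> is_derive t 1 (v ^~ x) (F (w t) x).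
  by case: (pselect (lip_path w)) => [/picard_step[v vP]|?]; [exists v|exists w].
pose w n := iter n P (fun=> a0).
have wlip n : lip_path (w n).
  elim: n => [|n IH]; last exact: (PP _ IH).1.
  by move=> s t x _ _; rewrite subrr normr0 mulr_ge0.
have wd n : forall x, w n.+1 0 x = a0 x /\
    forall t : R, 0 <= t -> is_derive t 1 (w n.+1 ^~ x) (F (w n t) x).
  exact: (PP _ (wlip n)).2.
(* The first iterate moves away from the constant path at speed at most [B], hence at most
   [B / K * K * expR (K * s)]; each further step halves the gap. *)
have wC n : near_path (B / K * 2^-1 ^+ n) (w n.+1) (w n).
  elim: n => [|n IH]; last first.
    by rewrite exprSr mulrA; apply: picard_contraction (wd n.+1) (wd n) IH.
  move=> t x t0; rewrite expr0 mulr1.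
  apply: (weighted_integration _ (w 1%N ^~ x - cst (a0 x))
    (fun s => F (w 0%N s) x) _ _ _ t0).
  - by rewrite divr_ge0// ltW.
  - by rewrite !fctE (wd 0%N x).1 subrr.
  - move=> s /andP[s0 _]; rewrite -[F _ _]subr0.
    by apply: is_deriveB; apply: (wd 0%N x).2; lra.
  - apply: (@is_derive_continuous_segment _ _ (fun s => F (w 0%N s) x)).
    move=> s /andP[s0 _]; rewrite -[F _ _]subr0.
    by apply: is_deriveB; apply: (wd 0%N x).2; lra.
  - move=> s /andP[s0 _]; rewrite (le_trans (F_bounded _ _))//.
    rewrite divfK ?gt_eqF//.
    by rewrite ler_peMr// -expR0 ler_expR mulr_ge0// ltW.
have /choice[l lP] (tx : R * X) : exists l, 0 <= tx.1 ->
    forall n, `|w n tx.1 tx.2 - l| <=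
      2 * (B / K * expR (K * tx.1)) * 2^-1 ^+ n.
  have [t0|] := leP 0 tx.1; last by exists 0.
  have [n|l lP] := @geometric_cauchy_limit _ (fun n => w n tx.1 tx.2)
    (B / K * expR (K * tx.1)).
    by rewrite mulrAC; exact: wC.
  by exists l.
pose W t x := l (t, x).
have WC n : near_path (2 * (B / K) * 2^-1 ^+ n) (w n) W.
  move=> t x t0; have /= := lP (t, x) t0 n.
  by move/le_trans; apply; rewrite le_eqVlt; apply/orP; left; apply/eqP; ring.
have Wlip : lip_path W.
  move=> s t x s0 t0.
  apply: (@le_geometric_error _ _ _
    (2 * (B / K) * (expR (K * s) + expR (K * t)))) => n.
  have := WC n s x s0; have := WC n t x t0; have := wlip n s t x s0 t0.
  rewrite !ler_norml; lra.
(* The limit [W] is a fixed point at nonnegative times: [P W] and [W] are both within a multiple of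
   [2^-1 ^+ n] of the iterate [w n.+1]. *)
have [Vlip VP] := PP _ Wlip.
have VW t : 0 <= t -> P W t = W t.
  move=> t0; apply/funext => x; apply/eqP; rewrite -subr_eq0 -normr_le0.
  apply: (@le_geometric_error _ _ _ (2 * (B / K) * expR (K * t))) => n.
  have := picard_contraction _ _ _ _ _ (wd n) VP (WC n) t x t0.
  have := WC n.+1 t x t0; rewrite exprSr /= -/(w n).
  rewrite !ler_norml; lra.
(* [W] is arbitrary at negative times, whereas the derivative at 0 is two-sided; [P W] agrees with
   [W] from time 0 on and is differentiable there. *)
exists (P W); split=> [|x|t x t0]; first by apply/funext => x; exact: (VP x).1.
  exact: field_continuous.
by rewrite VW//; exact: (VP x).2.
Qed.

End BoundedLipschitzODE.

(** * Lipschitz bounds for a C^1 function on bounded sets, and truncation *)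

Lemma C1_lipschitz (R : realType) (phi : R -> R) (M : R) :
  (forall x : R, derivable phi x 1) -> continuous (derive1 phi) ->
  exists2 L, 0 < L & forall a b, `|a| <= M -> `|b| <= M ->
    `|phi a - phi b| <= L * `|a - b|.
Proof.
move=> dphi cphi.
have [M0|M0] := ltP M 0.
  by exists 1 => // a b /(le_trans (normr_ge0 _)); rewrite leNgt M0.
have [||c _ cmax] := @EVT_max R (fun x => `|derive1 phi x|) (- M) M.
- lra.
- by apply: continuous_subspaceT => x; apply: cvg_norm; exact: cphi.
(* The maximum of the derivative's absolute value on [[- M, M]] may be 0; adding 1 makes the
   constant positive. *)
exists (`|derive1 phi c| + 1); first by rewrite ltr_wpDl.
have dphi' (x : R) : is_derive x 1 phi (derive1 phi x).
  by rewrite derive1E; exact: derivableP.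
suff mono a b : a <= b -> `|a| <= M -> `|b| <= M ->
    `|phi b - phi a| <= (`|derive1 phi c| + 1) * `|b - a|.
  move=> a b aM bM; have [ab|/ltW ba] := leP a b; last exact: mono.
  by rewrite distrC (distrC a); exact: mono.
move=> ab; rewrite ![`|_| <= M]ler_norml => aM bM.
rewrite (ger0_norm (x := b - a)) ?subr_ge0//.
apply: (@bounded_derive_lipschitz _ _ (derive1 phi)) => //.
- exact: is_derive_continuous_segment.
- move=> x xab; rewrite (@le_trans _ _ `|derive1 phi c|) ?lerDl//.
  by apply: cmax; rewrite in_itv/=; lra.
Qed.

Section Clamp.
Context {R : realType}.

Definition clamp (M r : R) := Num.max 0 (Num.min r M).

Lemma clamp_id M r : 0 <= r <= M -> clamp M r = r.
Proof. by move=> /andP[r0 rM]; rewrite /clamp (min_idPl rM) (max_idPr r0). Qed.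

Lemma clamp_le0 M r : r <= 0 -> clamp M r = 0.
Proof. by move=> r0; apply/max_idPl; rewrite ge_min r0. Qed.

Lemma clamp_bounds M r : 0 <= M -> 0 <= clamp M r <= M.
Proof. by move=> M0; rewrite /clamp le_max lexx ge_max M0 ge_min lexx orbT. Qed.

Lemma clamp_lipschitz M a b : `|clamp M a - clamp M b| <= `|a - b|.
Proof.
rewrite /clamp !maxEle !minEle.
case: (leP a M) => ?; case: (leP b M) => ?; do 2?[case: ifP => ?];
 rewrite ler_norml; have := ler_norm (a - b); have := ler_norm (b - a);
 rewrite (distrC b); lra.
Qed.

End Clamp.

(** * The discrete Neumann Laplacian: Lipschitz bound, minimum principle, conservation *)

Section GridLaplacian.
Context {R : realType} {k : nat}.
Variables (Omega : set 'rV[R]_k) (n : nat).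
Local Notation point := 'rV[R]_k.
Local Notation grid := (gridOmega Omega n).
Local Notation lap := (grid_lap Omega n).

Lemma finite_gridOmega : finite_set grid.
Proof.
(* Shifting the numerators by [n ^ 2] turns them into ordinals below [q.+1]. *)
pose q := (2 * n ^ 2)%N.
pose g (f : {ffun 'I_k -> 'I_q.+1}) : point :=
  \row_j (((f j)%:Z - (n ^ 2)%N%:Z)%:~R / n%:R).
apply: (@sub_finite_set _ _ (g @` setT)); last first.
  by apply: finite_image; exact: finite_finset.
move=> x [_ /choice[m mP]].
exists [ffun j => inord (absz (m j + (n ^ 2)%N%:Z)%R)] => //.
apply/rowP => j; rewrite mxE ffunE; have [mn ->] := mP j.
have h : (0 : int) <= m j + (n ^ 2)%N%:Z.
  by move: mn; rewrite -lez_nat abszE ler_norml; lra.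
congr (_%:~R / _); rewrite inordK ?gez0_abs//; first by rewrite addrK.
rewrite ltnS -lez_nat gez0_abs//.
by move: mn; rewrite -lez_nat abszE ler_norml /q mul2n -addnn PoszD; lra.
Qed.

Definition neighbor (x : point) (i : 'I_k) (b : bool) : point :=
  x + (-1) ^+ b *: (n%:R^-1 *: delta_mx 0 i).

Lemma grid_lapE f x : lap f x = n%:R^-1 ^- 2 * \sum_(i < k) \sum_(b : bool)
  (if neighbor x i b \in grid then f (neighbor x i b) - f x else 0).
Proof. by []. Qed.

(** The value at [x] is treated separately because [x] may lie off the grid: the differential
    equation is solved at all points of R^k. *)
Lemma eq_grid_lap f g x : f x = g x -> (forall y, grid y -> f y = g y) ->
  lap f x = lap g x.
Proof.
move=> fgx fg; rewrite !grid_lapE; congr (_ * _).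
apply: eq_bigr => i _; apply: eq_bigr => b _.
by case: ifPn => // /set_mem yG; rewrite fgx fg.
Qed.

(** A bound for the operator norm in the supremum norm: [k] directions, two neighbours in each, two
    values per difference. *)
Definition grid_lap_norm : R := n%:R^-1 ^- 2 * (k%:R * 4).

Lemma grid_lap_norm_ge0 : 0 <= grid_lap_norm.
Proof. by rewrite mulr_ge0// invr_ge0 exprn_ge0. Qed.

Lemma grid_lap_lipschitz f g x d : `|f x - g x| <= d ->
  (forall y, grid y -> `|f y - g y| <= d) ->
  `|lap f x - lap g x| <= grid_lap_norm * d.
Proof.
move=> fgx fg; have d0 : 0 <= d by rewrite (le_trans _ fgx).
rewrite !grid_lapE -mulrBr normrM ger0_norm ?invr_ge0 ?exprn_ge0//.
rewrite -mulrA ler_wpM2l ?invr_ge0 ?exprn_ge0//.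
rewrite -sumrB (le_trans (ler_norm_sum _ _ _))//.
rewrite (@le_trans _ _ (\sum_(i < k) 4 * d))//; last first.
  by rewrite sumr_const card_ord -[leLHS]mulr_natl mulrA.
apply: ler_sum => i _; rewrite -sumrB (le_trans (ler_norm_sum _ _ _))//.
rewrite (@le_trans _ _ (\sum_(b : bool) 2 * d))//; last first.
  by rewrite big_bool/=; lra.
apply: ler_sum => b _; case: ifPn => [/set_mem yG|_]; last first.
  by rewrite subrr normr0 mulr_ge0.
by have := fg _ yG; move: fgx; rewrite !ler_norml; lra.
Qed.

Lemma grid_lap_bounded f x d : (forall y, `|f y| <= d) ->
  `|lap f x| <= grid_lap_norm * d.
Proof.
move=> fd; have -> : lap f x = lap f x - lap (cst 0) x.
  suff -> : lap (cst 0) x = 0 by rewrite subr0.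
  rewrite grid_lapE big1 ?mulr0// => i _; rewrite big1// => b _.
  by rewrite subrr; case: ifP.
by apply: grid_lap_lipschitz => [|y _]; rewrite subr0.
Qed.

(** Discrete minimum principle: no neighbour on the grid has a value below [f x], so every summand
    is nonnegative. *)
Lemma grid_lap_ge0 f x : f x = 0 -> (forall y, grid y -> 0 <= f y) ->
  0 <= lap f x.
Proof.
move=> fx f0; rewrite grid_lapE mulr_ge0 ?invr_ge0 ?exprn_ge0//.
apply: sumr_ge0 => i _; apply: sumr_ge0 => b _.
by case: ifPn => // /set_mem yG; rewrite fx subr0 f0.
Qed.

Lemma neighborK i b x : neighbor (neighbor x i b) i (~~ b) = x.
Proof.
rewrite /neighbor -addrA -scalerDl.
by case: b; rewrite expr0 expr1 ?addNr ?subrr scale0r addr0.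
Qed.

(** Every edge between two grid points is counted once from each end, with opposite differences;
    dropping the neighbours outside the grid leaves no boundary term. *)
Lemma sum_grid_lap f : \sum_(x \in grid) lap f x = 0.
Proof.
have fG := finite_gridOmega.
under eq_fsbigr do rewrite grid_lapE.
rewrite -mulr_fsumr fsbig_finite// exchange_big/= big1 ?mulr0// => i _.
rewrite exchange_big big_bool/= -!fsbig_finite//.
pose J b := [set x | neighbor x i b \in grid].
have JE b : \sum_(x \in grid) (if neighbor x i b \in grid
      then f (neighbor x i b) - f x else 0) =
    \sum_(x \in grid `&` J b) (f (neighbor x i b) - f x).
  rewrite [RHS]fsbig_mkcondr !fsbig_finite//; apply: eq_bigr => x _.
  by congr (if _ then _ else _); apply/idP/idP => [?|/set_mem//]; exact: mem_set.
(* The backward step is a bijection from the grid points with a backward neighbour onto those with a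
   forward one; after this substitution the two sums cancel termwise. *)
rewrite !JE (@reindex_fsbig _ _ _ _ _ (neighbor ^~ i ^~ true)
  (grid `&` J true) (grid `&` J false)).
  rewrite -fsbig_split; last exact: finite_setIl.
  apply: fsbig1 => x _.
  by rewrite /= (neighborK i true) -[X in _ + X]opprB subrr.
split.
- by move=> x [/= xG xJ]; split; [exact: set_mem|rewrite /J/= neighborK mem_set].
- move=> x y _ _ /(congr1 (fun z => neighbor z i (~~ true))).
  by rewrite !neighborK.
- move=> y [/= yG yJ]; exists (neighbor y i false).
    by split; [exact: set_mem|rewrite /J/= (neighborK i false) mem_set].
  exact: (neighborK i false).
Qed.

End GridLaplacian.

(** * Derivatives relative to the half-line, and a barrier argument *)

Section HalfLine.
Context {R : realType}.
Implicit Types (w : R -> R) (t : R).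
Local Notation punctured t := (within `[0, +oo[ t^').

(** Properness gives uniqueness of the limit defining [time_deriv]; points to the right of [t] are
    available even at 0. *)
Lemma punctured_halfline_proper t : 0 <= t -> ProperFilter (punctured t).
Proof.
move=> t0; apply: Build_ProperFilter_ex => P [e /= e0 Pe].
exists (t + e / 2); apply: Pe => /=.
- by rewrite opprD addNKr normrN gtr0_norm ?divr_gt0// ltr_pdivrMr// ltr_pMr// ltr1n.
- by rewrite gt_eqF// ltrDl divr_gt0.
- by rewrite in_itv/= andbT addr_ge0// ltW// divr_gt0.
Qed.

Lemma is_derive_time_quot w t d : is_derive t 1 w d ->
  time_quot w t s @[s --> punctured t] --> d.
Proof.
move=> [dw <-]; apply/cvgrPdist_lt => e e0.
have /cvgrPdist_lt/(_ e e0)[r /= r0 rP] := dw.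
exists r => //= s st sNt _; have sN : s - t != 0 by rewrite subr_eq0.
have := rP (s - t); rewrite /= sub0r normrN distrC => /(_ st sN).
by rewrite /time_quot [_ *: 1]mulr1 subrK mulrC.
Qed.

Lemma is_derive_time_deriv w t d : 0 <= t -> is_derive t 1 w d ->
  time_deriv w t = d.
Proof.
move=> t0 /is_derive_time_quot; have FF := punctured_halfline_proper t t0.
by apply: cvg_lim; exact: Rhausdorff.
Qed.

Lemma time_deriv_is_derive w t : 0 < t ->
  cvg (time_quot w t s @[s --> punctured t]) -> is_derive t 1 w (time_deriv w t).
Proof.
move=> t0 cw.
have dw : (fun h => h^-1 *: ((w \o shift t) (h *: (1 : R)) - w t)) @ 0^' -->
    time_deriv w t.
  apply/cvgrPdist_lt => e e0; have /cvgrPdist_lt/(_ e e0)[r /= r0 rP] := cw.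
  (* The radius is at most [t] so that [h + t] remains in the half-line. *)
  exists (Num.min r t) => /=; first by rewrite lt_min r0.
  move=> h /=; rewrite sub0r normrN lt_min => /andP[hr ht] h0.
  have := rP (h + t); rewrite /= /time_quot addrK opprD addrCA subrr addr0 normrN.
  rewrite [h *: 1]mulr1 (mulrC _ h^-1); apply=> //.
    by rewrite -subr_eq0 addrK.
  rewrite in_itv/= andbT; move: ht; rewrite ltr_norml; lra.
by split; [apply/cvg_ex; exists (time_deriv w t)|exact: cvg_lim dw].
Qed.

(** Near [t] the difference quotients are bounded by [|d| + 1], where [d] is their limit; this
    forces continuity, also at the endpoint 0. *)
Lemma C1_halfline_continuous w T : C1_halfline w ->
  {within `[0, T], continuous w}.
Proof.
move=> [cw _]; apply/subspace_continuousP => t /=; rewrite in_itv/= => /andP[t0 _].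
apply/cvgrPdist_lt => e e0; have /cvgrPdist_lt/(_ 1 ltr01)[r /= r0 rP] := cw t t0.
set d := lim _ in rP.
have d0 : 0 < `|d| + 1 by rewrite ltr_wpDl.
exists (Num.min r (e / (`|d| + 1))) => /=; first by rewrite lt_min r0 divr_gt0.
move=> s /=; rewrite lt_min => /andP[sr se]; rewrite in_itv/= => /andP[s0 _].
have [->|sNt] := eqVneq s t; first by rewrite subrr normr0.
have := rP s sr sNt; rewrite /= in_itv/= s0 => /(_ isT) q1.
have qd : `|time_quot w t s| < `|d| + 1.
  have := ler_normD (time_quot w t s - d) d; rewrite subrK.
  by move: q1; rewrite distrC; lra.
have -> : w t - w s = time_quot w t s * (t - s).
  by rewrite /time_quot; field; rewrite subr_eq0.
rewrite normrM (le_lt_trans (y := (`|d| + 1) * `|t - s|))//.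
  by rewrite ler_wpM2r// ltW.
by rewrite mulrC -ltr_pdivlMr.
Qed.

(** If [w t < 0], consider the last time before [t] at which [w] is nonnegative. After it [w] is
    negative, so its derivative is nonnegative and [w] cannot have decreased. *)
Lemma nonneg_barrier w (dw : R -> R) :
  (forall t, 0 <= t -> is_derive t 1 w (dw t)) -> 0 <= w 0 ->
  (forall t, 0 <= t -> w t <= 0 -> 0 <= dw t) -> forall t, 0 <= t -> 0 <= w t.
Proof.
move=> wd w0 dw0 t t0; rewrite leNgt; apply/negP => wt.
pose S := [set s | 0 <= s <= t /\ 0 <= w s].
have S0 : S 0 by split; [rewrite lexx|].
have Sub : ubound S t by move=> s [/andP[]].
have supS : has_sup S by split; [exists 0|exists t].
have s0 : 0 <= sup S by apply: ub_le_sup => //; exists t.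
have st : sup S <= t by apply: ge_sup => //; exists 0.
(* The supremum belongs to [S]: a negative value there would persist, by continuity, at elements of
   [S] close to it. *)
have ws : 0 <= w (sup S).
  rewrite leNgt; apply/negP => ws.
  have wc : {for sup S, continuous w}.
    by apply/differentiable_continuous/derivable1_diffP; case: (wd _ s0).
  have [r /= r0 rP] := cvgr_lt _ wc _ ws.
  have [s [s0t ws0]] := sup_adherent r0 supS.
  have sS : s <= sup S by apply: ub_le_sup; [exists t|].
  move=> rs; have : w s < 0.
    by apply: rP; rewrite /= ger0_norm ?subr_ge0//; lra.
  lra.
have {}st : sup S < t.
  by rewrite lt_neqAle st andbT; apply: contraTneq ws => ->; rewrite -ltNge.
have wd' x : x \in `]sup S, t[%R -> is_derive x 1 w (dw x).
  by move=> xt; apply: wd; rewrite (le_trans s0)// (itvP xt).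
have [|c ct e] := MVT st wd'.
  by apply: (is_derive_continuous_segment _ _ dw) => x /andP[sx _]; apply: wd; lra.
have c0 : 0 <= c by rewrite (le_trans s0)// (itvP ct).
have wc : w c < 0.
  rewrite ltNge; apply/negP => wc.
  have : c <= sup S.
    by apply: ub_le_sup; [exists t|split=> //; rewrite c0 (itvP ct)].
  by rewrite leNgt (itvP ct).
have : 0 <= dw c * (t - sup S).
  by rewrite mulr_ge0 ?subr_ge0// ?dw0// ltW.
by rewrite -e; lra.
Qed.

Lemma is_derive_sum_seq (T : eqType) (r : seq T) (w dw : T -> R -> R) t :
  (forall x, x \in r -> is_derive t 1 (w x) (dw x t)) ->
  is_derive t 1 (fun s => \sum_(x <- r) w x s) (\sum_(x <- r) dw x t).
Proof.
elim: r => [_|x r IH wd].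
  rewrite big_nil (_ : (fun _ => _) = cst 0); first exact: is_derive_cst.
  by apply/funext => s; rewrite big_nil.
rewrite big_cons (_ : (fun _ => _) = w x + (fun s => \sum_(x <- r) w x s)).
  apply: is_deriveD; first by apply: wd; rewrite mem_head.
  by apply: IH => y yr; apply: wd; rewrite inE yr orbT.
by apply/funext => s; rewrite big_cons.
Qed.

End HalfLine.

(** * Existence and uniqueness at a standard grid parameter *)

Lemma finite_common_bound (R : realType) (S : Type) (T : choiceType) (A : set T)
    (f : T -> S -> R) (D : set S) :
  finite_set A ->
  (forall x, A x -> exists M, forall s, D s -> `|f x s| <= M) ->
  exists M, forall x s, A x -> D s -> `|f x s| <= M.
Proof.
move=> fA bnd.
have /choice[b bP] x : exists M, A x -> forall s, D s -> `|f x s| <= M.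
  have [/bnd[M MP]|?] := pselect (A x); first by exists M.
  by exists 0.
(* The sum of the absolute values of the individual bounds dominates each of them. *)
exists (\sum_(x \in A) `|b x|) => x s Ax Ds.
rewrite (le_trans (bP x Ax s Ds))// (fsbigD1 x)//= (le_trans (ler_norm _))//.
by rewrite lerDl fsumr_ge0.
Qed.

Section StandardGridProblem.
Context {R : realType} {k : nat}.
Variables (Omega : set 'rV[R]_k) (n : nat) (phi : R -> R) (u0 : 'rV[R]_k -> R).
Local Notation point := 'rV[R]_k.
Local Notation grid := (gridOmega Omega n).
Local Notation lap := (grid_lap Omega n).
Hypotheses (dphi : forall x : R, derivable phi x 1)
  (cphi : continuous (derive1 phi)).

(** The counterpart of [solves] at a single index of the ultrapower. *)
Definition standard_solution (u : R -> point -> R) : Prop :=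
  [/\ C1_grid Omega n u,
      forall t x, 0 <= t -> grid x ->
        time_deriv (u ^~ x) t = lap (phi \o u t) x &
      forall x, grid x -> u 0 x = u0 x].

(* Clamping the state to [0, M], where M is the conserved total mass, makes the
   vector field bounded and globally Lipschitz without changing the solution,
   which stays in [0, M]. *)
Lemma standard_solution_exists :
  (forall x, 0 <= x -> 0 <= phi x) -> phi 0 = 0 ->
  (forall x, grid x -> 0 <= u0 x) -> exists u, standard_solution u.
Proof.
move=> phi_ge0 phi0 u0_ge0.
have fG := finite_gridOmega Omega n.
have le_mass (f : point -> R) x : grid x -> (forall y, grid y -> 0 <= f y) ->
    f x <= \sum_(y \in grid) f y.
  move=> Gx f0; rewrite (fsbigD1 x)//= lerDl.
  by apply: fsumr_ge0 => y [Gy _]; exact: f0.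
pose M := \sum_(x \in grid) u0 x.
have M0 : 0 <= M by exact: fsumr_ge0.
have [L L0 phiL] := C1_lipschitz _ _ M dphi cphi.
pose psi r := phi (clamp M r).
have cM r : `|clamp M r| <= M.
  by have /andP[c0 cM] := clamp_bounds M r M0; rewrite ger0_norm.
have psi_lip a b : `|psi a - psi b| <= L * `|a - b|.
  by rewrite (le_trans (phiL _ _ _ _))// ler_wpM2l ?clamp_lipschitz// ltW.
have psi_le0 r : r <= 0 -> psi r = 0 by move=> r0; rewrite /psi clamp_le0.
have psi_ge0 r : 0 <= psi r.
  by apply: phi_ge0; case/andP: (clamp_bounds M r M0).
have psi_bound r : `|psi r| <= L * M.
  have := phiL (clamp M r) 0 (cM r); rewrite phi0 !subr0 normr0 => /(_ M0).
  by move/le_trans; apply; rewrite ler_wpM2l ?cM// ltW.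
have C0 : 0 <= grid_lap_norm (R := R) (k := k) n by exact: grid_lap_norm_ge0.
(* The summand 1 keeps the Lipschitz constant positive when [grid_lap_norm] is 0. *)
have [||||w [w0 wc wd]] := @bounded_lipschitz_ode R point
    (fun a => lap (psi \o a)) (grid_lap_norm (R := R) (k := k) n * L + 1)
    (grid_lap_norm (R := R) (k := k) n * (L * M)) u0.
- by rewrite ltr_wpDl// mulr_ge0// ltW.
- by rewrite !mulr_ge0// ltW.
- by move=> a x; apply: grid_lap_bounded => y; exact: psi_bound.
- move=> a b d abd x; have d0 : 0 <= d by exact: le_trans (abd x).
  rewrite (@le_trans _ _ (grid_lap_norm (R := R) (k := k) n * (L * d)))//.
    have h y : `|(psi \o a) y - (psi \o b) y| <= L * d.
      by rewrite (le_trans (psi_lip _ _))// ler_wpM2l// ltW.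
    by apply: grid_lap_lipschitz.
  by rewrite mulrDl mul1r -mulrA lerDl.
have {}w0 x : w 0 x = u0 x by rewrite w0.
(* Where [w] is nonpositive, [psi] vanishes, so that point is a minimum of [psi \o w s] and the
   Laplacian there is nonnegative. *)
have w_ge0 t x : 0 <= t -> grid x -> 0 <= w t x.
  move=> t0 Gx; apply: (nonneg_barrier (w ^~ x) (fun s => lap (psi \o w s) x)) => //.
  - by rewrite w0 u0_ge0.
  - by move=> s s0 ws; apply: grid_lap_ge0; rewrite //= psi_le0.
have w_mass t : 0 <= t -> \sum_(x \in grid) w t x = M.
  move=> t0.
  have md (s : R) : 0 <= s -> is_derive s 1 (fun s => \sum_(x \in grid) w s x) 0.
    move=> s0; have := is_derive_sum_seq _ (finmap.enum_fset (fset_set grid))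
      (fun x s => w s x) (fun x s => lap (psi \o w s) x) s (fun x _ => wd s x s0).
    rewrite -fsbig_finite// sum_grid_lap.
    by under eq_fun do rewrite -fsbig_finite//.
  have -> : M = \sum_(x \in grid) w 0 x by apply: eq_fsbigr => x _; rewrite w0.
  apply/eqP; rewrite -subr_eq0 -normr_le0.
  rewrite (le_trans (@bounded_derive_lipschitz _ (fun s => \sum_(x \in grid) w s x)
    (cst 0) 0 _ _ t0 _ _ _)) ?mul0r//.
  + by move=> s /andP[s0 _]; apply: md; exact: ltW.
  + apply: (is_derive_continuous_segment _ _ (cst 0)) => s /andP[s0 _].
    exact: md.
  + by move=> s _; rewrite normr0.
(* A nonnegative value is at most the total mass [M], so the clamp is inactive along the
   solution. *)
have w_eq t x : 0 <= t -> grid x -> lap (psi \o w t) x = lap (phi \o w t) x.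
  move=> t0 Gx.
  have h y : grid y -> psi (w t y) = phi (w t y).
    move=> Gy; rewrite /psi clamp_id// w_ge0//= -(w_mass t t0).
    by apply: le_mass => // z; exact: w_ge0.
  by apply: eq_grid_lap => //=; exact: h.
have w_deriv t x : 0 <= t -> time_deriv (w ^~ x) t = lap (psi \o w t) x.
  by move=> t0; apply: is_derive_time_deriv => //; exact: wd.
exists w; split=> [x Gx|t x t0 Gx|x _].
- split=> [t t0|].
    by apply/cvg_ex; eexists; apply: is_derive_time_quot; exact: wd.
  apply/subspace_continuousP => t /=; rewrite in_itv/= andbT => t0.
  rewrite /from_subspace w_deriv// -{2}(max_idPl t0).
  apply: cvg_trans (cvg_within_filter _ (wc x t)).
  apply: fmap_within_eq => s /set_mem; rewrite /= in_itv/= andbT => s0.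
  by rewrite w_deriv// (max_idPl s0).
- by rewrite w_deriv// w_eq.
- by rewrite w0.
Qed.

(** On [[0, T]] both solutions are bounded, so [phi] is Lipschitz along them. Iterating the weighted
    contraction then halves the bound on their difference indefinitely. *)
Lemma standard_solution_unique u v : standard_solution u ->
  standard_solution v -> forall t x, 0 <= t -> grid x -> u t x = v t x.
Proof.
move=> [uC ud ui] [vC vd vi] T x0 T0 Gx0.
have fG := finite_gridOmega Omega n.
have bnd w : C1_grid Omega n w -> exists M, forall x s, grid x ->
    0 <= s <= T -> `|w s x| <= M.
  move=> wC; apply: (@finite_common_bound _ _ _ _ (fun x s => w s x)
    [set s | 0 <= s <= T]) => // x Gx.
  have [|c _ cP] := @EVT_max R (fun s => `|w s x|) _ _ T0.
    by move=> s; apply: cvg_norm; exact: (C1_halfline_continuous _ _ (wC x Gx)).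
  by exists `|w c x| => s sT; apply: cP; rewrite in_itv.
have [Mu uM] := bnd u uC; have [Mv vM] := bnd v vC.
have [L L0 phiL] := C1_lipschitz _ _ (Num.max Mu Mv) dphi cphi.
set C := grid_lap_norm (R := R) (k := k) n.
have C0 : 0 <= C by exact: grid_lap_norm_ge0.
(* This exponent exceeds twice the Lipschitz constant [C * L] of the vector field, so each
   integration gains at least a factor one half. *)
pose K := 2 * (C * L + 1).
have K0 : 0 < K by rewrite mulr_gt0// ltr_wpDl// mulr_ge0// ltW.
pose D := `|Mu| + `|Mv|.
have D0 : 0 <= D by rewrite addr_ge0.
have step m : forall s x, 0 <= s <= T -> grid x ->
    `|u s x - v s x| <= D * 2^-1 ^+ m * expR (K * s).
  elim: m => [|m IH] s x sT Gx; move: (sT) => /andP[s0 sT'].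
    rewrite expr0 mulr1 (@le_trans _ _ D)//.
      rewrite /D (le_trans (ler_normB _ _))// lerD// (le_trans _ (ler_norm _))//.
      by rewrite uM.
      by rewrite vM.
    by rewrite ler_peMr// -expR0 ler_expR mulr_ge0// ltW.
  have inT r : 0 <= r <= s -> 0 <= r <= T.
    by move=> /andP[-> rs]; rewrite (le_trans rs).
  apply: (weighted_integration _ (u ^~ x - v ^~ x)
    (fun s => lap (phi \o u s) x - lap (phi \o v s) x) _ _ _ s0).
  - by rewrite mulr_ge0// exprn_ge0// invr_ge0.
  - by rewrite !fctE ui// vi// subrr.
  - move=> r /andP[r0 rs]; rewrite -ud ?ltW// -vd ?ltW//.
    apply: is_deriveB; apply: time_deriv_is_derive => //.
      by apply: (uC x Gx).1; exact: ltW.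
    by apply: (vC x Gx).1; exact: ltW.
  - by move=> r; apply: continuousB; apply: C1_halfline_continuous;
      [exact: uC|exact: vC].
  - move=> r rs; have h y : grid y -> `|(phi \o u r) y - (phi \o v r) y| <=
        L * (D * 2^-1 ^+ m * expR (K * r)).
      move=> Gy; rewrite (le_trans (phiL _ _ _ _))//.
      - by rewrite le_max uM//; exact: inT.
      - by rewrite le_max vM ?orbT//; exact: inT.
      - by rewrite ler_wpM2l ?IH//; [exact: ltW|exact: inT].
    rewrite (le_trans (grid_lap_lipschitz _ _ _ _ _ _ (h x Gx) h))// -/C.
    rewrite exprS /K; set E := D * _ * expR _.
    have E0 : 0 <= E by rewrite !mulr_ge0 ?expR_ge0// exprn_ge0// invr_ge0.
    rewrite (_ : D * _ * _ * _ = (C * L + 1) * E); last by rewrite /E; field.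
    by rewrite mulrA ler_wpM2r// lerDl.
apply/eqP; rewrite -subr_eq0 -normr_le0.
apply: (@le_geometric_error _ _ _ (D * expR (K * T))) => m.
rewrite add0r mulrAC; apply: step => //.
by rewrite T0 lexx.
Qed.

End StandardGridProblem.

(** * Transfer between the ultrapower and its indices *)

Lemma ultra_forall (I T : Type) (U : filter_on I) (P Q : I -> T -> Prop) :
  UltraFilter U ->
  (forall x : I -> T, (\forall i \near U, P i (x i)) ->
    \forall i \near U, Q i (x i)) ->
  \forall i \near U, forall x, P i x -> Q i x.
Proof.
move=> hU PQ.
(* Maximality of the filter enters here: otherwise the indices with a counterexample form a set of
   [U], and chosen counterexamples assemble into an internal point violating [PQ]. *)
have [//|nPQ] := in_ultra_setVsetC [set i | forall x, P i x -> Q i x] hU.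
have ex i : ~ (forall x, P i x -> Q i x) -> exists x, P i x /\ ~ Q i x.
  by move=> /existsNP[x /not_implyP[Px Qx]]; exists x.
(* One counterexample serves as the default value at the remaining indices. *)
have [i0 /ex[x0 _]] := filter_ex nPQ.
have /choice[x xP] i : exists x, ~ (forall x, P i x -> Q i x) -> P i x /\ ~ Q i x.
  by have [?|/ex[x ?]] := pselect (forall x, P i x -> Q i x); [exists x0|exists x].
have Px : \forall i \near U, P i (x i) by apply: filterS nPQ => i /xP[].
have [i [nPQi Qx]] := filter_ex (filterI nPQ (PQ x Px)).
by have [_ /(_ Qx)] := xP i nPQi.
Qed.

Lemma sapp_eq (I A B : Type) (U : filter_on I) (F : star U (A -> B)) (x : star U A)
    (F' : I -> A -> B) (x' : I -> A) :
  F = star_of U F' -> x = star_of U x' ->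
  F <@> x = star_of U (fun i => F' i (x' i)).
Proof. by move=> -> ->; rewrite sapp_star_of. Qed.
Arguments sapp_eq {I A B U F x F' x'} _ _.

Section Transfer.
Context {I : Type} (U : filter_on I) {R : realType} {k : nat}.
Variables (Omega : set 'rV[R]_k) (N : I -> nat).
Local Notation point := 'rV[R]_k.
Local Notation N0 := (star_of U N).
Local Notation grid i := (gridOmega Omega (N i)`!).

Lemma gridNE : gridN N0 = star_of U (fun i => (N i)`!).
Proof. by rewrite /gridN /std sapp_star_of. Qed.

Lemma OmegaXE (x : I -> point) :
  OmegaX Omega N0 (star_of U x) <-> \forall i \near U, grid i (x i).
Proof. by rewrite /OmegaX gridNE /std !sapp_star_of holdsP. Qed.

(** The pairing only sums over the grid, so the pairings with each test function are equal, not
    merely infinitely close. *)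
Lemma eq_gclass (f g : I -> point -> R) :
  (\forall i \near U, forall x, grid i x -> f i x = g i x) ->
  gclass Omega N0 (star_of U f) = gclass Omega N0 (star_of U g).
Proof.
move=> fg; apply/eqmodP/asboolP => psi _.
suff -> : gpairing Omega N0 (star_of U f) psi = gpairing Omega N0 (star_of U g) psi.
  exact: sapprox_refl.
have [p ->] := star_ofP psi.
rewrite /gpairing gridNE /std !sapp_star_of; apply/star_of_eq.
apply: filterS fg => i fg; rewrite /grid_pairing; congr (_ * _).
by apply: eq_fsbigr => x /set_mem Gx; rewrite fg.
Qed.

Lemma time_deriv_starE (u : I -> R -> point -> R) (t : I -> R) (x : I -> point) :
  std U (fun (v : R -> point -> R) s y => time_deriv (v ^~ y) s)
    <@> star_of U u <@> star_of U t <@> star_of U x =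
  star_of U (fun i => time_deriv (u i ^~ (x i)) (t i)).
Proof.
pose D (v : R -> point -> R) s y := time_deriv (v ^~ y) s.
exact: sapp_eq (sapp_eq (sapp_star_of U (fun=> D) u) erefl) erefl.
Qed.

Lemma glap_gcompE (phi : R -> R) (u : I -> R -> point -> R) (t : I -> R)
    (x : I -> point) :
  glap Omega N0 (gcomp phi (star_of U u <@> star_of U t)) <@> star_of U x =
  star_of U (fun i => grid_lap Omega (N i)`! (phi \o u i (t i)) (x i)).
Proof.
have E : gcomp phi (star_of U u <@> star_of U t) =
    star_of U (fun i => phi \o u i (t i)).
  pose c (g : point -> R) := phi \o g.
  exact: (sapp_eq (F := star_of U (fun=> c)) erefl (sapp_star_of U u t)).
rewrite /glap gridNE E.
exact: sapp_eq (sapp_eq (sapp_star_of U (fun=> grid_lap Omega) _) erefl) erefl.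
Qed.

Lemma initial_valueE (u0 : point -> R) (u : I -> R -> point -> R) (x : I -> point) :
  (star_of U u <@> std U 0 <@> star_of U x = std U u0 <@> star_of U x) <->
  \forall i \near U, u i 0 (x i) = u0 (x i).
Proof.
rewrite (sapp_eq (sapp_star_of U u (fun=> 0)) (erefl (star_of U x))).
by rewrite sapp_star_of star_of_eq.
Qed.

(** An instance of the transfer principle: [ultra_forall] turns the quantifiers over internal times
    and points into quantifiers at almost every index. *)
Lemma solvesP (phi : R -> R) (u0 : point -> R) (u : I -> R -> point -> R) :
  UltraFilter U ->
  solves Omega N0 phi u0 (star_of U u) <->
  \forall i \near U, standard_solution Omega (N i)`! phi u0 (u i).
Proof.
move=> hU; rewrite /solves gridNE (sapp_eq (sapp_star_of U (fun=> C1_grid Omega) _) erefl).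
split=> [[/holdsP uC ud ui]|uS].
  (* Time and point are paired so that [ultra_forall] handles both quantifiers at once. *)
  have {}ud : \forall i \near U, forall tx : R * point, 0 <= tx.1 /\ grid i tx.2 ->
      time_deriv (u i ^~ tx.2) tx.1 = grid_lap Omega (N i)`! (phi \o u i tx.1) tx.2.
    apply: (@ultra_forall _ _ _ (fun i tx => 0 <= tx.1 /\ grid i tx.2)) => // tx txG.
    apply/star_of_eq; rewrite -glap_gcompE -ud ?time_deriv_starE//.
      by apply/star_predE; apply: filterS txG => i [].
    by apply/OmegaXE; apply: filterS txG => i [].
  have {}ui : \forall i \near U, forall x, grid i x -> u i 0 x = u0 x.
    apply: (@ultra_forall _ _ _ (fun i x => grid i x)) => // x.
    by move=> /OmegaXE/ui/initial_valueE.
  apply: filterS3 uC ud ui => i uC ud ui; split=> // t x t0 Gx.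
  exact: (ud (t, x)).
split.
- by apply/holdsP; apply: filterS uS => i [].
- move=> t x; have [t' ->] := star_ofP t; have [x' ->] := star_ofP x.
  move=> /star_predE t0 /OmegaXE Gx.
  rewrite time_deriv_starE glap_gcompE; apply/star_of_eq.
  by apply: filterS3 uS t0 Gx => i [_ + _]; apply.
- move=> x; have [x' ->] := star_ofP x => /OmegaXE Gx; apply/initial_valueE.
  by apply: filterS2 uS Gx => i [_ _]; apply.
Qed.

End Transfer.

Theorem proposition4p8 (R : realType) (I : Type) (U : filter_on I)
    (k : nat) (Omega : set 'rV[R]_k) (nhat : 'rV[R]_k -> 'rV[R]_k)
    (u0 : 'rV[R]_k -> R) (phi : R -> R) (N0 : star U nat)
    (hU : UltraFilter U) (hk : (0 < k)%N)
    (hOpen : open Omega) (hBounded : bounded_set Omega)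
    (hConnected : connected Omega) (hBoundary : smooth_boundary Omega nhat)
    (hu0 : in_Linfty Omega u0) (hu0_ge0 : forall x, Omega x -> 0 <= u0 x)
    (hphi : phi_hyp phi) (hN0 : infinite_hypernat N0) :
  exists! p, grid_solution Omega N0 phi u0 p.
Proof.
have [[dphi cphi] [phi_ge0 phi0] _] := hphi.
have [N {hN0}->] := star_ofP N0.
have /choice[u uS] i :
    exists u, standard_solution Omega (N i)`! phi u0 u.
  by apply: standard_solution_exists => // x [Ox _]; exact: hu0_ge0.
have uSol : solves Omega (star_of U N) phi u0 (star_of U u).
  by apply/solvesP; exact: filterE.
eexists; split; first by exists (star_of U u).
move=> _ [w' + ->]; have [w ->] := star_ofP w' => /(solvesP _ _ _ _ _ _ hU) wS.
(* Classes are only taken at standard times, which are represented by constant families; at almost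
   every index uniqueness gives agreement on the whole grid. *)
have uw (t : R) : 0 <= t -> \forall i \near U, forall x,
    gridOmega Omega (N i)`! x -> u i t x = w i t x.
  move=> t0; apply: filterS wS => i wi x Gx.
  exact: standard_solution_unique dphi cphi _ _ (uS i) wi _ _ t0 Gx.
congr pair; apply/funext => -[t t0] /=;
  rewrite /gcomp /std !sapp_star_of; apply: eq_gclass.
  exact: uw.
by apply: filterS (uw t t0) => i uwi x Gx /=; rewrite uwi.
Qed.
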